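(* Let $r>0$ be fixed. 1. Suppose that $b$ satisfies all the drift conditions stated in the context. Then there exists a constant $L>0$ depending only on $\lambda$, $\gamma$ and the constant $c$ from the bounds $b(t,y)\ge\frac{c}{(y-\varphi(t))^\gamma}$, $(t,y)\in\mathcal D_{0,0}\setminus\mathcal D_{y_*,0}$, and $b(t,y)\le-\frac{c}{(\psi(t)-y)^\gamma}$, $(t,y)\in\mathcal D_{0,0}\setminus\mathcal D_{0,y_*}$, such that the solution $Y$ to the equation $Y_t=Y_0+\int_0^t b(s,Y_s)\,ds+Z_t$, $t\in[0,T]$, has the property $$\varphi(t)+L\tilde\Lambda^{-\frac{1}{\gamma\lambda+\lambda-1}}\ \le\ Y_t\ \le\ \psi(t)-L\tilde\Lambda^{-\frac{1}{\gamma\lambda+\lambda-1}},\qquad t\in[0,T],$$ where $$\tilde\Lambda:=\max\left\{\Lambda,\ K,\ (4\beta)^{\lambda-1}\left(\frac{(Y_0-\varphi(0))\wedge y_*\wedge(\psi(0)-Y_0)}{2}\right)^{1-\lambda-\gamma\lambda}\right\}$$ with $$\beta:=\frac{\lambda^{\frac{\lambda}{1-\lambda}}-\lambda^{\frac{1}{1-\lambda}}}{(2^\gamma c)^{\frac{\lambda}{1-\lambda}}}>0$$ and $K$ being such that $|\varphi(t)-\varphi(s)|+|\psi(t)-\psi(s)|\le K|t-s|^\lambda$ for all $t,s\in[0,T]$. 2. If, in addition, $\Lambda$ can be chosen in such a way that $\mathbb E\Lambda^{\frac{r}{\gamma\lambda+\lambda-1}}<\infty$, then $$\mathbb E\Big[\sup_{t\in[0,T]}(Y_t-\varphi(t))^{-r}\Big]<\infty\quad\text{and}\quad\mathbb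 E\Big[\sup_{t\in[0,T]}(\psi(t)-Y_t)^{-r}\Big]<\infty.$$
   Context: Fix $T\in(0,\infty)$ and $\lambda\in(0,1)$. Let $\varphi,\psi:[0,T]\to\mathbb R$ be $\lambda$-Hölder continuous functions with $\varphi(t)<\psi(t)$ for all $t\in[0,T]$. For $a_1,a_2\ge 0$ let $\mathcal D_{a_1,a_2}:=\{(t,y) : t\in[0,T],\ y\in(\varphi(t)+a_1,\psi(t)-a_2)\}$. $\|\cdot\|_\infty$ is the sup norm on $[0,T]$. The initial value $Y_0$ is a deterministic constant with $\varphi(0)<Y_0<\psi(0)$. The noise $Z=\{Z_t,\ t\in[0,T]\}$ is a stochastic process such that $Z_0=0$ a.s. and there is a random variable $\Lambda=\Lambda(\omega)\in(0,\infty)$ with $|Z_t-Z_s|\le\Lambda|t-s|^\lambda$ for all $t,s\in[0,T]$. All equations are understood pathwise. Assumptions on the drift $b$: (B1) $b:\mathcal D_{0,0}\to\mathbb R$ is continuous. (B2) For any $\varepsilon_1,\varepsilon_2>0$ with $\varepsilon_1+\varepsilon_2<\|\varphi-\psi\|_\infty$ there is a constant $c_{\varepsilon_1,\varepsilon_2}>0$ such that $|b(t,y_1)-b(t,y_2)|\le c_{\varepsilon_1,\varepsilon_2}|y_1-y_2|$ for all $(t,y_1),(t,y_2)\in\mathcal D_{\varepsilon_1,\varepsilon_2}$. (B3) There are constants $\gamma>0$, $y_*>0$ with $y_*<\frac12\|\varphi-\psi\|_\infty$, and $c>0$ such that $b(t,y)\ge\frac{c}{(y-\varphi(t))^\gamma}$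 for all $(t,y)\in\mathcal D_{0,0}\setminus\mathcal D_{y_*,0}$, and $b(t,y)\le-\frac{c}{(\psi(t)-y)^\gamma}$ for all $(t,y)\in\mathcal D_{0,0}\setminus\mathcal D_{0,y_*}$. (B4) The constant $\gamma$ from (B3) satisfies $\gamma>\frac{1-\lambda}{\lambda}$. Under (B1)–(B4) the equation has a unique continuous solution $Y$ on $[0,T]$, and $\varphi(t)<Y_t<\psi(t)$ for all $t\in[0,T]$. *)

(* Defs.v *)
From mathcomp Require Import all_boot all_order all_algebra.
From mathcomp Require Import all_classical all_reals all_analysis.
Set Implicit Arguments.
Unset Strict Implicit.
Unset Printing Implicit Defensive.
Import Order.TTheory GRing.Theory Num.Theory.
Import numFieldNormedType.Exports.
Local Open Scope classical_set_scope.
Local Open Scope ring_scope.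

Definition supnorm (R : realType) (T : R) (f : R -> R) : R :=
  sup [set `|f t| | t in `[0, T]].

(* [0 `^ lambda = 0] for [lambda != 0], so the case [s = t] is harmless. *)
Definition holder_with (R : realType) (T lambda C : R) (f : R -> R) : Prop :=
  forall s t, t \in `[0, T] -> s \in `[0, T] ->
    `|f t - f s| <= C * `|t - s| `^ lambda.

Definition holder_continuous (R : realType) (T lambda : R) (f : R -> R) : Prop :=
  exists C, holder_with T lambda C f.

(* The set D_{a1,a2}. *)
Definition drift_domain (R : realType) (T : R) (phi psi : R -> R) (a1 a2 : R) :
    set (R * R) :=
  [set p | p.1 \in `[0, T] /\ phi p.1 + a1 < p.2 < psi p.1 - a2].

(* In the drift conditions and in the equation, the drift [b] is a total
   function of the pair [(t, y)]; its values outside [drift_domain T phi psi 0 0] are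
   never used. *)
Definition drift_continuous (R : realType) (T : R) (phi psi : R -> R)
    (b : R * R -> R) : Prop :=
  {within drift_domain T phi psi 0 0, continuous b}.

Definition drift_lipschitz (R : realType) (T : R) (phi psi : R -> R)
    (b : R * R -> R) : Prop :=
  forall e1 e2 : R, 0 < e1 -> 0 < e2 ->
    e1 + e2 < supnorm T (fun t => phi t - psi t) ->
  exists2 C : R, 0 < C &
    forall t y1 y2,
      drift_domain T phi psi e1 e2 (t, y1) -> drift_domain T phi psi e1 e2 (t, y2) ->
      `|b (t, y1) - b (t, y2)| <= C * `|y1 - y2|.

Definition drift_explosive (R : realType) (T : R) (phi psi : R -> R)
    (b : R * R -> R) (gamma ystar c : R) : Prop :=
  [/\ 0 < gamma, 0 < ystar,
      ystar < 2^-1 * supnorm T (fun t => phi t - psi t) & 0 < c] /\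
  (forall t y,
     (drift_domain T phi psi 0 0 `\` drift_domain T phi psi ystar 0) (t, y) ->
     c / (y - phi t) `^ gamma <= b (t, y)) /\
  (forall t y,
     (drift_domain T phi psi 0 0 `\` drift_domain T phi psi 0 ystar) (t, y) ->
     b (t, y) <= - (c / (psi t - y) `^ gamma)).

(* [y] is a continuous solution of the equation driven by the path [z]. As the
   drift is only meaningful on [drift_domain T phi psi 0 0], a solution has to stay
   there. *)
Definition is_solution (R : realType) (T : R) (phi psi : R -> R)
    (b : R * R -> R) (Y0 : R) (z y : R -> R) : Prop :=
  [/\ {within `[0, T], continuous y},
      forall t, t \in `[0, T] -> phi t < y t < psi t &
      forall t, t \in `[0, T] ->
        y t = Y0 + \int[lebesgue_measure]_(s in `[0, t]) b (s, y s) + z t].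

Definition is_holder_constant (R : realType) (d : measure_display)
    (Omega : measurableType d) (P : probability Omega R) (T lambda : R)
    (Z : R -> {RV P >-> R}) (Lambda : {RV P >-> R}) : Prop :=
  forall w, 0 < Lambda w /\ holder_with T lambda (Lambda w) (fun t => Z t w).

Definition is_noise (R : realType) (d : measure_display)
    (Omega : measurableType d) (P : probability Omega R) (T lambda : R)
    (Z : R -> {RV P >-> R}) : Prop :=
  {ae P, forall w, Z 0 w = 0} /\
  exists Lambda : {RV P >-> R}, is_holder_constant T lambda Z Lambda.

Definition beta_const (R : realType) (lambda gamma c : R) : R :=
  (lambda `^ (lambda / (1 - lambda)) - lambda `^ (1 / (1 - lambda))) /
  ((2 `^ gamma * c) `^ (lambda / (1 - lambda))).

(* The random constant tilde-Lambda at a fixed sample point: [Lambda] is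
   the value of the noise constant, [p0] and [q0] are phi(0) and psi(0). *)
Definition Lambda_tilde (R : realType)
    (lambda gamma c ystar Y0 p0 q0 K Lambda : R) : R :=
  Num.max (Num.max Lambda K)
    ((4 * beta_const lambda gamma c) `^ (lambda - 1) *
     (Num.min (Num.min (Y0 - p0) ystar) (q0 - Y0) / 2)
       `^ (1 - lambda - gamma * lambda)).

(* Main.v *)
Require Import Defs.
From mathcomp Require Import all_boot all_order all_algebra.
From mathcomp Require Import all_classical all_reals all_analysis.
From mathcomp Require Import measurable_realfun.
From mathcomp Require Import ring lra.
Import Order.TTheory GRing.Theory Num.Theory.
Import numFieldNormedType.Exports.
Local Open Scope classical_set_scope.
Local Open Scope ring_scope.

(** The solution stays away from the boundary because the drift there is so
    strong that it beats the Hoelder noise. Write [u = Y - phi], and let [e] be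
    a height not exceeding [Y0 - phi 0] and [ystar]. If [u t < e], let [tau] be
    the last time before [t] at which [u >= e]. On [(tau, t]] the drift is at
    least [A = c / e `^ gamma], while the noise and the boundary together move
    by at most [B h `^ lambda] with [h = t - tau] and [B] twice the random
    constant Lambda-tilde. Hence
    [u t >= e + A h - B h `^ lambda], and everything comes down to choosing [e]
    with [A h - B h `^ lambda >= - e / 2] for every [h >= 0]
    ([powR_le_linear]); then [u >= e / 2] throughout
    ([repulsion_lower_bound]).

    Both terms scale with powers of [e] and of Lambda-tilde, and the height
    [e = 2 L Lambda_tilde `^ (- 1 / q)], where
    [q = gamma lambda + lambda - 1 > 0], makes the inequality independent of
    Lambda-tilde: it is then a smallness condition on [L] alone, with a bound in
    [lambda], [gamma] and [c] ([explosive_balance]). The third entry of the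
    maximum defining Lambda-tilde is what bounds [e] by the initial distances
    and by [ystar], for [L] small in the same parameters ([barrier_below]). The
    upper boundary is the same statement for [u = psi - Y], whose drift is
    [- b].

    For the moments, the pathwise bound gives
    [(Y t - phi t) `^ (- r) <= L `^ (- r) Lambda_tilde `^ (r / q)] for almost
    every sample point, and a power of a maximum of [Lambda] with a constant is
    at most the sum of the powers. The supremum over time need not be
    measurable, so the comparison of integrals goes through the definition of
    the integral by simple functions ([le_integral_ae_dominated]). *)

(** * Comparing a linear function with a power *)

(** Compare [h] with [h1 = (e / (2 B)) `^ (1 / lambda)], at which the power
    term equals [e / 2]: before [h1] the constant suffices, and after [h1] the
    assumption says precisely that the linear term has overtaken the power. *)
Lemma powR_le_linear (R : realType) (lambda A B e h : R) :
  0 < lambda < 1 -> 0 < A -> 0 < B -> 0 < e -> 0 <= h ->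
  B <= A * (e / (2 * B)) `^ ((1 - lambda) / lambda) ->
  B * h `^ lambda <= A * h + e / 2.
Proof.
move=> /andP[l0 l1] A0 B0 e0 h0 AB.
set h1 := (e / (2 * B)) `^ lambda^-1.
have d0 : 0 < e / (2 * B) by rewrite divr_gt0// mulr_gt0.
have h10 : 0 < h1 by exact: powR_gt0.
have h1l : h1 `^ lambda = e / (2 * B).
  by rewrite /h1 -powRrM mulVf ?gt_eqF// powRr1// ltW.
have [hh1|h1h] := leP h h1.
- have : h `^ lambda <= h1 `^ lambda.
    by apply: ge0_ler_powR => //; rewrite ?nnegrE ?ltW.
  rewrite h1l => /(ler_wpM2l (ltW B0)) /le_trans; apply.
  have -> : B * (e / (2 * B)) = e / 2 by field; rewrite gt_eqF.
  by rewrite lerDr mulr_ge0// ltW.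
- have hp0 : 0 < h by exact: lt_trans h1h.
  have h1' : h1 `^ (1 - lambda) <= h `^ (1 - lambda).
    by apply: ge0_ler_powR; rewrite ?nnegrE ?subr_ge0 ?ltW.
  have BA : B <= A * h `^ (1 - lambda).
    apply: (le_trans AB); rewrite ler_pM2l//; apply: le_trans h1'.
    by rewrite /h1 -powRrM (mulrC lambda^-1).
  have E : h `^ (1 - lambda) * h `^ lambda = h.
    by rewrite -powRD ?subrK ?powRr1// oner_eq0.
  rewrite -{2}E mulrA.
  apply: (@le_trans _ _ (A * h `^ (1 - lambda) * h `^ lambda)); last first.
    by rewrite lerDl divr_ge0// ltW.
  by rewrite ler_wpM2r// powR_ge0.
Qed.

(** The height [e] is chosen proportional to [x `^ (- (1 / q))] because both
    sides are then proportional to [x]; what remains is the condition on [L]. *)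
Lemma explosive_balance (R : realType) (lambda gamma c x L : R)
    (q := gamma * lambda + lambda - 1) (e := 2 * L * x `^ (- (1 / q))) :
  0 < lambda -> 0 < q -> 0 < c -> 0 < x -> 0 < L ->
  (2 * L) `^ (q / lambda) <= c / 2 * 4 `^ (- ((1 - lambda) / lambda)) ->
  2 * x <= c / e `^ gamma * (e / (2 * (2 * x))) `^ ((1 - lambda) / lambda).
Proof.
move=> l0 q0 c0 x0 L0 Lq.
(* In logarithms of the parameters the two inequalities are affine, and their
   defects coincide. *)
have [X xE] := expR_total x0.
have [l lE] : exists l, expR l = 2 * L by apply: expR_total; rewrite mulr_gt0.
have [k kE] : exists k, expR k = c / 2 by apply: expR_total; rewrite divr_gt0.
have [f fE] : exists f, expR f = 4 :> R by apply: expR_total.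
have [w wE] : exists w, expR w = 2 :> R by apply: expR_total.
have eE : e = expR (l - X / q).
  by rewrite /e -lE -xE -expRM -expRD; congr expR; field; rewrite gt_eqF.
have cE : c = expR (k + w) by rewrite expRD kE wE; field.
move: Lq; rewrite -lE -kE -fE -!expRM -expRD ler_expR => Lq.
have -> : e / (2 * (2 * x)) = expR (l - X / q - f - X).
  by rewrite eE (expRB _ X) (expRB _ f) fE -xE; field; rewrite gt_eqF// expR_gt0.
rewrite cE eE -expRM -expRB -expRM -expRD -xE -wE -expRD ler_expR -subr_ge0.
move: Lq; rewrite -subr_ge0.
suff -> : k + f * - ((1 - lambda) / lambda) - l * (q / lambda) =
  k + w - (l - X / q) * gamma
    + (l - X / q - f - X) * ((1 - lambda) / lambda) - (w + X) by [].
have qN0 := lt0r_neq0 q0.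
by move: qN0; rewrite /q => qN0; field; rewrite qN0 gt_eqF.
Qed.

(** * Paths driven by an upward drift near a barrier *)

Lemma holder_within_continuous (R : realType) (T lambda C : R) (f : R -> R) :
  0 < lambda -> holder_with T lambda C f -> {within `[0, T], continuous f}.
Proof.
move=> l0 hf; apply/subspace_continuousP => x xT.
apply/cvgrPdist_lt => e e0; rewrite near_withinE.
have d0 : 0 < e / (`|C| + 1) by rewrite divr_gt0// ltr_wpDl.
exists ((e / (`|C| + 1)) `^ lambda^-1) => /=; first exact: powR_gt0.
move=> y /= xy yT; apply: le_lt_trans (hf y x _ _) _ => //.
have xyl : `|x - y| `^ lambda < e / (`|C| + 1).
  have : `|x - y| `^ lambda < ((e / (`|C| + 1)) `^ lambda^-1) `^ lambda.
    by apply: gt0_ltr_powR; rewrite ?nnegrE ?powR_ge0.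
  by rewrite -powRrM mulVf ?gt_eqF// powRr1// ltW.
apply: (@le_lt_trans _ _ ((`|C| + 1) * `|x - y| `^ lambda)).
  rewrite ler_wpM2r ?powR_ge0//; have := ler_norm C; lra.
by rewrite mulrC -ltr_pdivlMr// ltr_wpDl.
Qed.

Lemma within_continuous_comp2 (R : realType) (A : set R) (D : set (R * R))
    (b : R * R -> R) (y : R -> R) :
  {within D, continuous b} -> {within A, continuous y} ->
  (forall t, A t -> D (t, y t)) ->
  {within A, continuous (fun t => b (t, y t))}.
Proof.
move=> /subspace_continuousP cb /subspace_continuousP cy AD.
apply/subspace_continuousP => x Ax.
have : (fun t => (t, y t)) @ within A (nbhs x) --> within D (nbhs (x, y x)).
  have xy : (fun t => (t, y t)) @ within A (nbhs x) --> (x, y x).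
    have idx : (fun t : R => t) @ within A (nbhs x) --> x by exact: cvg_within.
    exact: cvg_pair idx (cy _ Ax).
  move=> U /xy xU.
  have {}xU : nbhs x (fun t => A t -> D (t, y t) -> U (t, y t)) by exact: xU.
  suff : nbhs x (fun t => A t -> U (t, y t)) by [].
  by apply: filterS xU => t + At => /(_ At); apply; exact: AD.
move=> h; exact: cvg_comp h (cb _ (AD _ Ax)).
Qed.

(** The last time is a supremum; continuity is what makes [u] reach the level
    at the supremum itself. *)
Lemma last_exit (R : realType) (T e t : R) (u : R -> R) :
  {within `[0, T], continuous u} -> e <= u 0 -> t \in `[0, T] ->
  exists tau, [/\ 0 <= tau <= t, e <= u tau &
    forall s, tau < s -> s <= t -> u s < e].
Proof.
move=> /subspace_continuousP cu e0 tT.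
have /andP[t0 tT'] : 0 <= t <= T by move: tT; rewrite in_itv.
pose A := [set s | 0 <= s <= t /\ e <= u s].
have A0 : A 0 by rewrite /A/= lexx t0.
have hA : has_sup A.
  by split; [exists 0|exists t => s /= [/andP[_ ->]]].
have s0 : 0 <= sup A by exact: ub_le_sup hA.2 _ A0.
have st : sup A <= t by apply: ge_sup; [exists 0|move=> s /= [/andP[_ ->]]].
exists (sup A); split; first by rewrite s0.
(* If [u] were below [e] at the supremum, it would be so on a neighbourhood,
   which contains points of the set. *)
- rewrite leNgt; apply/negP => ue.
  have sT : `[0, T]%classic (sup A) by rewrite /= in_itv/= s0 (le_trans st).
  have /cvgrPdist_lt /(_ (e - u (sup A))) := cu _ sT.
  rewrite subr_gt0 => /(_ ue); rewrite near_withinE => -[d /= d0 dP].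
  have [s As ds] := sup_adherent d0 hA.
  have sA : s <= sup A by exact: ub_le_sup hA.2 _ As.
  move: As => /= [/andP[s0' st'] us].
  have /= := dP s; rewrite in_itv/= s0' (le_trans st' tT').
  have dd : `|sup A - s| < d.
    by rewrite ger0_norm ?subr_ge0// ltrBlDr -ltrBlDl.
  move=> /(_ dd isT); rewrite ltr_norml => /andP[+ _].
  by rewrite opprB ltrD2l ltrN2 ltNge us.
- move=> s ss st'; rewrite ltNge; apply/negP => es.
  have : A s by rewrite /A/= st' es (le_trans s0 (ltW ss)).
  by move=> /(ub_le_sup hA.2); rewrite leNgt ss.
Qed.

(** From the last time at height at least [e], the drift pushes up at rate at least [A]
    for as long as the path stays lower, so that [powR_le_linear] bounds the
    depth of any excursion below [e] by [e / 2]. The forcing [zeta] gathers the noise and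
    the moving boundary. *)
Lemma repulsion_lower_bound (R : realType) (T lambda A B e u0 : R)
    (u g zeta : R -> R) :
  0 < lambda < 1 -> 0 < A -> 0 < B -> 0 < e ->
  B <= A * (e / (2 * B)) `^ ((1 - lambda) / lambda) ->
  {within `[0, T], continuous u} -> {within `[0, T], continuous g} ->
  holder_with T lambda B zeta ->
  (forall t, t \in `[0, T] ->
    u t = u0 + \int[lebesgue_measure]_(s in `[0, t]) g s + zeta t) ->
  e <= u 0 -> (forall t, t \in `[0, T] -> u t <= e -> A <= g t) ->
  forall t, t \in `[0, T] -> e / 2 <= u t.
Proof.
move=> l01 A0 B0 e0 AB cu cg hz uE ue gA t tT.
have [tau [/andP[tau0 taut] utau ult]] := last_exit _ _ _ _ _ cu ue tT.
have /andP[t0 tT'] : 0 <= t <= T by move: tT; rewrite in_itv.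
have tauT : tau \in `[0, T] by rewrite in_itv/= tau0 (le_trans taut).
have mu_g : lebesgue_measure.-integrable `[0, t] (EFin \o g).
  have mu_gT : lebesgue_measure.-integrable `[0, T] (EFin \o g).
    by apply: continuous_compact_integrable => //; exact: segment_compact.
  apply: integrableS mu_gT => //.
  by apply: subset_itvl; rewrite bnd_simp.
have intE : \int[lebesgue_measure]_(s in `[0, t]) g s -
    \int[lebesgue_measure]_(s in `[0, tau]) g s =
    \int[lebesgue_measure]_(s in `]tau, t]) g s.
  by apply: Rintegral_itvB => //; rewrite bnd_simp.
have int_ge : A * (t - tau) <= \int[lebesgue_measure]_(s in `]tau, t]) g s.
  have mut : lebesgue_measure `]tau, t] = (t - tau)%:E :> \bar R.
    rewrite lebesgue_measure_itv/= lte_fin -EFinB.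
    case: ifPn => //; rewrite -leNgt => ttau.
    by rewrite (le_anti (introT andP (conj taut ttau))) subrr.
  have -> : A * (t - tau) = \int[lebesgue_measure]_(s in `]tau, t]) A.
    rewrite Rintegral_cst//; congr (_ * _).
    exact: (congr1 fine (esym mut)).
  apply: le_Rintegral => //.
  - have int_cst : lebesgue_measure.-integrable `[tau, t] (EFin \o cst A).
      apply: continuous_compact_integrable; first exact: segment_compact.
      by apply: continuous_subspaceT => s; exact: cst_continuous.
    apply: integrableS int_cst => //.
    by apply: subset_itvr; rewrite bnd_simp.
  - apply: integrableS mu_g => //.
    by apply: subset_itvr; rewrite bnd_simp.
  - move=> s /=; rewrite in_itv/= => /andP[taus st].
    apply: gA; last exact/ltW/ult.
    by rewrite in_itv/= (le_trans tau0 (ltW taus)) (le_trans st).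
have hh : `|t - tau| = t - tau by rewrite ger0_norm ?subr_ge0.
have := powR_le_linear _ _ _ _ _ _ l01 A0 B0 e0 _ AB => /(_ (t - tau)).
rewrite subr_ge0 => /(_ taut) tradeoff.
have := hz tau t tT tauT; rewrite hh ler_norml => /andP[zlow _].
have u_incr : A * (t - tau) + (zeta t - zeta tau) <= u t - u tau.
  apply: le_trans (lerD int_ge (lexx _)) _.
  by rewrite -intE (uE _ tT) (uE _ tauT) le_eqVlt; apply/orP; left; apply/eqP; ring.
by move: u_incr tradeoff zlow utau; clear; lra.
Qed.

(** * The constant of the barrier *)

Lemma beta_const_gt0 (R : realType) (lambda gamma c : R) :
  0 < lambda < 1 -> 0 < c -> 0 < beta_const lambda gamma c.
Proof.
move=> /andP[l0 l1] c0; have l1' : 0 < 1 - lambda by rewrite subr_gt0.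
apply: divr_gt0; last by rewrite powR_gt0// mulr_gt0// powR_gt0.
have -> : 1 / (1 - lambda) = lambda / (1 - lambda) + 1.
  by field; rewrite gt_eqF.
have lN0 : lambda != 0 by rewrite gt_eqF.
rewrite powRD ?lN0 ?implybT// powRr1 ?ltW// subr_gt0.
by rewrite gtr_pMr// powR_gt0.
Qed.

(** The first entry of the minimum makes the drift win at the scale of the barrier
    ([barrier_const_balanced]), the second keeps the barrier below the distances
    [m] that it must not exceed at time [0] ([barrier_below]). *)
Definition barrier_const {R : realType} (lambda gamma c : R) : R :=
  Num.min ((c / 2 * 4 `^ (- ((1 - lambda) / lambda)))
             `^ (lambda / (gamma * lambda + lambda - 1)) / 2)
          ((4 * beta_const lambda gamma c)
             `^ ((lambda - 1) / (gamma * lambda + lambda - 1))).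

Lemma barrier_const_gt0 (R : realType) (lambda gamma c : R) :
  0 < lambda < 1 -> 0 < c -> 0 < barrier_const lambda gamma c.
Proof.
move=> l01 c0; rewrite lt_min; apply/andP; split.
  by rewrite divr_gt0// powR_gt0// !mulr_gt0// powR_gt0.
by rewrite powR_gt0// mulr_gt0// beta_const_gt0.
Qed.

Lemma barrier_const_balanced (R : realType) (lambda gamma c : R) :
  0 < lambda < 1 -> 0 < c -> 0 < gamma * lambda + lambda - 1 ->
  (2 * barrier_const lambda gamma c)
     `^ ((gamma * lambda + lambda - 1) / lambda)
  <= c / 2 * 4 `^ (- ((1 - lambda) / lambda)).
Proof.
move=> l01 c0 q0; have /andP[l0 _] := l01.
have Lc0 := barrier_const_gt0 _ _ gamma _ l01 c0.
set a := c / 2 * _; set q := gamma * lambda + lambda - 1.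
have a0 : 0 < a by rewrite mulr_gt0 ?divr_gt0 ?powR_gt0.
have : 2 * barrier_const lambda gamma c <= a `^ (lambda / q).
  by rewrite mulrC -ler_pdivlMr// ge_min lexx.
have ql0 : 0 <= q / lambda by rewrite divr_ge0 ?ltW.
move=> /(ge0_ler_powR ql0) La.
apply: (@le_trans _ _ ((a `^ (lambda / q)) `^ (q / lambda))).
- by apply: La; rewrite nnegrE ?powR_ge0// mulr_ge0// ltW.
- have qq : lambda / q * (q / lambda) = 1 by rewrite mulrA divfK ?divff ?gt_eqF.
  by rewrite -powRrM qq powRr1// ltW.
Qed.

(** Raising the hypothesis to the power [- (1 / q)] turns it into
    [x `^ (- (1 / q)) <= (4 beta) `^ ((1 - lambda) / q) * (m / 2)], whose
    prefactor the constant of the barrier cancels. *)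
Lemma barrier_below (R : realType) (lambda gamma c x m : R)
    (q := gamma * lambda + lambda - 1) :
  0 < lambda < 1 -> 0 < c -> 0 < q -> 0 < m -> 0 < x ->
  (4 * beta_const lambda gamma c) `^ (lambda - 1) *
    (m / 2) `^ (1 - lambda - gamma * lambda) <= x ->
  2 * barrier_const lambda gamma c * x `^ (- (1 / q)) <= m.
Proof.
move=> l01 c0 q0 m0 x0 kx; set B := 4 * beta_const lambda gamma c in kx.
have B0 : 0 < B by rewrite mulr_gt0// beta_const_gt0.
have LB : barrier_const lambda gamma c <= B `^ ((lambda - 1) / q).
  by rewrite ge_min lexx orbT.
have mB : B `^ ((lambda - 1) / q) <= m / 2 * x `^ (1 / q).
  have -> : B `^ ((lambda - 1) / q) =
      m / 2 * (B `^ (lambda - 1) *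
        (m / 2) `^ (1 - lambda - gamma * lambda)) `^ (1 / q).
    rewrite powRM ?powR_ge0// -!powRrM.
    have -> : (1 - lambda - gamma * lambda) * (1 / q) = -1.
      by move: (lt0r_neq0 q0); rewrite /q => qN0; field.
    rewrite powR_inv1 ?divr_ge0 ?ltW// mul1r.
    by rewrite [in RHS]mulrCA divff ?mulr1// gt_eqF// divr_gt0.
  apply: ler_wpM2l; first by rewrite divr_ge0 ?ltW.
  apply: ge0_ler_powR => //; first by rewrite divr_ge0 ?ltW.
    by rewrite nnegrE mulr_ge0 ?powR_ge0.
  by rewrite nnegrE ltW.
rewrite powRN ler_pdivrMr ?powR_gt0//; lra.
Qed.

(** * Both boundaries, for one sample path *)

(** Two instances of [repulsion_lower_bound]: [y - phi] with drift [b], and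
    [psi - y] with drift [- b]. *)
Lemma sample_path_bounds (R : realType) (lambda gamma c : R)
    (T ystar Y0 Lam K : R) (phi psi z y : R -> R) (b : R * R -> R)
    (M := barrier_const lambda gamma c *
       Lambda_tilde lambda gamma c ystar Y0 (phi 0) (psi 0) K Lam
         `^ (- (1 / (gamma * lambda + lambda - 1)))) :
  0 < lambda < 1 -> 0 < gamma * lambda + lambda - 1 -> 0 < T ->
  phi 0 < Y0 < psi 0 ->
  drift_continuous T phi psi b ->
  drift_explosive T phi psi b gamma ystar c ->
  0 < Lam -> holder_with T lambda Lam z -> z 0 = 0 ->
  (forall s t, t \in `[0, T] -> s \in `[0, T] ->
      `|phi t - phi s| + `|psi t - psi s| <= K * `|t - s| `^ lambda) ->
  is_solution T phi psi b Y0 z y ->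
  forall t, t \in `[0, T] -> phi t + M <= y t <= psi t - M.
Proof.
move=> l01 q0 T0 /andP[pY Yp] cb [[g0 ys0 _ c0] [blow bup]] Lam0 hz z0 hK.
move=> [cy yin ysol].
have /andP[l0 l1] := l01.
move: @M; set x := Lambda_tilde _ _ _ _ _ _ _ _ _ => M.
have xLam : Lam <= x by rewrite !le_max lexx.
have xK : K <= x by rewrite !le_max lexx orbT.
have x0 : 0 < x by exact: lt_le_trans xLam.
have L0 := barrier_const_gt0 _ _ gamma _ l01 c0.
set e := 2 * barrier_const lambda gamma c *
  x `^ (- (1 / (gamma * lambda + lambda - 1))).
have e0 : 0 < e by rewrite !mulr_gt0// powR_gt0.
have Me : M = e / 2 by rewrite /M /e; field.
have : e <= Num.min (Num.min (Y0 - phi 0) ystar) (psi 0 - Y0).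
  apply: barrier_below => //; first by rewrite !lt_min !subr_gt0 pY ys0.
  by rewrite le_max lexx orbT.
rewrite !le_min -andbA => /and3P[eY eys eYp].
have A0 : 0 < c / e `^ gamma by rewrite divr_gt0 ?powR_gt0.
have B0 : 0 < 2 * x by rewrite mulr_gt0.
have AB := explosive_balance _ _ _ _ _ _ l0 q0 c0 x0 L0
  (barrier_const_balanced _ _ _ _ l01 c0 q0).
(* The nearer to the boundary, the stronger the drift. *)
have stronger v : 0 < v -> v <= e -> c / e `^ gamma <= c / v `^ gamma.
  move=> v0 ve; rewrite ler_pM2l// lef_pV2 ?posrE ?powR_gt0//.
  by apply: ge0_ler_powR => //; rewrite ?nnegrE; exact: ltW.
have z0T : 0 \in `[0, T] by rewrite in_itv/= lexx ltW.
have y0E : y 0 = Y0.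
  by rewrite ysol// set_itv1 Rintegral_set1 z0 !addr0.
have hphi : holder_with T lambda K phi.
  by move=> s t tT sT; apply: le_trans (hK s t tT sT); rewrite lerDl.
have hpsi : holder_with T lambda K psi.
  by move=> s t tT sT; apply: le_trans (hK s t tT sT); rewrite lerDr.
(* The factor [2]: one [x] for the noise, one for the boundary. *)
have hsub f : holder_with T lambda K f ->
    forall s t, t \in `[0, T] -> s \in `[0, T] ->
    `|(z t - z s) - (f t - f s)| <= 2 * x * `|t - s| `^ lambda.
  move=> hf s t tT sT; apply: le_trans (ler_normB _ _) _.
  apply: le_trans (lerD (hz _ _ tT sT) (hf _ _ tT sT)) _.
  rewrite -mulrDl ler_wpM2r ?powR_ge0//; lra.
have inD t : t \in `[0, T] -> drift_domain T phi psi 0 0 (t, y t).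
  by move=> tT; split => //=; rewrite addr0 subr0 yin.
have cg : {within `[0, T], continuous (fun t => b (t, y t))}.
  exact: (within_continuous_comp2 _ _ _ _ _ cb cy).
have int_g t : t \in `[0, T] ->
    lebesgue_measure.-integrable `[0, t] (EFin \o (fun s => b (s, y s))).
  rewrite in_itv/= => /andP[_ tT].
  have gT : lebesgue_measure.-integrable `[0, T] (EFin \o (fun s => b (s, y s))).
    by apply: continuous_compact_integrable => //; exact: segment_compact.
  apply: integrableS gT => //.
  by apply: subset_itvl; rewrite bnd_simp.
move=> t tT; rewrite Me; apply/andP; split.
- rewrite addrC -lerBrDr.
  apply: (repulsion_lower_bound _ T lambda _ _ e Y0 (fun t => y t - phi t)
    (fun t => b (t, y t)) (fun t => z t - phi t) l01 A0 B0 e0 AB) => //.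
  + by apply: within_continuousB => //; exact: holder_within_continuous hphi.
  + move=> s r rT sT /=; have := hsub _ hphi s r rT sT.
    by rewrite (_ : z r - z s - _ = z r - phi r - (z s - phi s))//; ring.
  + by move=> s sT; rewrite ysol// addrA.
  + by rewrite y0E.
  + move=> s sT ue; have /andP[ylow _] := yin s sT.
    apply: le_trans (stronger (y s - phi s) _ ue) _; first by rewrite subr_gt0.
    apply: blow; split; first exact: inD.
    by move=> [_ /= /andP[]]; lra.
- rewrite lerBrDr addrC -lerBrDr.
  apply: (repulsion_lower_bound _ T lambda _ _ e (- Y0) (fun t => psi t - y t)
    (fun t => -1 * b (t, y t)) (fun t => psi t - z t) l01 A0 B0 e0 AB) => //.
  + by apply: within_continuousB => //; exact: holder_within_continuous hpsi.
  + by move=> s; apply: cvgM; [exact: cvg_cst|exact: cg].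
  + move=> s r rT sT /=; have := hsub _ hpsi s r rT sT.
    suff -> : psi r - z r - (psi s - z s) = - (z r - z s - (psi r - psi s)).
      by rewrite normrN.
    ring.
  + by move=> s sT; rewrite ysol// RintegralZl ?int_g//; ring.
  + by rewrite y0E.
  + move=> s sT ue; have /andP[_ yup] := yin s sT.
    apply: le_trans (stronger (psi s - y s) _ ue) _; first by rewrite subr_gt0.
    rewrite mulN1r lerNr; apply: bup; split; first exact: inD.
    by move=> [_ /= /andP[]]; lra.
Qed.

(** * Inverse moments *)

Section nonmeasurable_domination.
Import HBNNSimple.

(** The integral of a nonnegative [f] is the supremum of the integrals of the
    simple functions below [f] everywhere, and each of these is below [g] almost
    everywhere; so [f] may be nonmeasurable. *)
Lemma le_integral_ae_dominated d (Om : measurableType d) (R : realType)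
    (mu : {measure set Om -> \bar R}) (f : Om -> \bar R) (g : Om -> R) :
  (forall w, 0 <= f w)%E -> measurable_fun [set: Om] g -> (forall w, 0 <= g w) ->
  {ae mu, forall w, (f w <= (g w)%:E)%E} ->
  (\int[mu]_w f w <= \int[mu]_w (g w)%:E)%E.
Proof.
move=> f0 mg g0 fg; rewrite [leLHS]ge0_integralTE//.
apply: ge_ereal_sup => _ [h /= hf <-]; rewrite -integralT_nnsfun.
apply: ae_ge0_le_integral => //.
- by move=> x _; rewrite lee_fin; exact: fun_ge0.
- apply/measurable_EFinP. exact: measurable_funPT.
- by move=> x _; rewrite lee_fin.
- by apply/measurable_EFinP.
- by apply: filterS fg => w fgw _; exact: le_trans (hf w) fgw.
Qed.

End nonmeasurable_domination.

(** A power of the maximum is at most the sum of the powers, and the one of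
    [kappa] is integrable because [P] is finite. *)
Lemma integral_sup_powRN_lty d (Om : measurableType d) (R : realType)
    (P : probability Om R) (S : set R) (t0 : R) (U : R -> Om -> R)
    (l p r kappa : R) (X : Om -> R) :
  S t0 -> 0 < l -> 0 < r ->
  measurable_fun [set: Om] X -> (forall w, 0 < X w) ->
  ('E_P[fun w => (X w `^ (p * r))%R] < +oo)%E ->
  {ae P, forall w, forall t, S t ->
    l * Num.max (X w) kappa `^ (- p) <= U t w} ->
  (\int[P]_w ereal_sup [set ((U t w) `^ (- r))%R%:E | t in S] < +oo)%E.
Proof.
move=> St0 l0 r0 mX X0 EX lU.
pose g w := l `^ (- r) * (X w `^ (p * r) + kappa `^ (p * r)).
have mXp : measurable_fun [set: Om] (fun w => X w `^ (p * r)).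
  by apply: (measurableT_comp (measurable_powR _)).
have iX : P.-integrable [set: Om] (EFin \o (fun w => X w `^ (p * r))).
  apply/integrableP; split; first exact/measurable_EFinP.
  under eq_integral do rewrite /= ger0_norm ?powR_ge0//.
  by move: EX; rewrite unlock.
have ig : P.-integrable [set: Om] (EFin \o g).
  rewrite (_ : EFin \o g = fun w => ((l `^ (- r))%R%:E *
    ((EFin \o (fun w => (X w `^ (p * r))%R)) w
      + (EFin \o cst (kappa `^ (p * r))%R) w))%E)//.
  apply: integrableZl => //; apply: integrableD => //.
  exact: finite_measure_integrable_cst.
apply: (@le_lt_trans _ _ (\int[P]_w (g w)%:E)%E); last first.
  exact: integrable_lty.
apply: le_integral_ae_dominated.
- move=> w; apply: le_trans (ereal_sup_ubound _); last by exists t0.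
  by rewrite lee_fin powR_ge0.
- by apply/measurable_EFinP; exact: measurable_int ig.
- by move=> w; rewrite mulr_ge0 ?addr_ge0 ?powR_ge0.
- apply: filterS lU => w lU; apply: ge_ereal_sup => _ [t St <-]; rewrite lee_fin.
  have m0 : 0 < Num.max (X w) kappa by rewrite lt_max X0.
  have lm0 : 0 < l * Num.max (X w) kappa `^ (- p) by rewrite mulr_gt0// powR_gt0.
  apply: (@le_trans _ _ ((l * Num.max (X w) kappa `^ (- p)) `^ (- r))).
    rewrite 2!(powRN _ r) lef_pV2 ?posrE ?powR_gt0 ?(lt_le_trans lm0 (lU _ St))//.
    apply: ge0_ler_powR; rewrite ?nnegrE ?(ltW lm0) ?(ltW r0) ?lU//.
    exact: le_trans (ltW lm0) (lU _ St).
  rewrite powRM ?powR_ge0 ?(ltW l0)// -powRrM mulrNN /g ler_pM2l ?powR_gt0//.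
  by case: (leP (X w) kappa) => _; rewrite ?lerDl ?lerDr powR_ge0.
Qed.

Theorem theorem3p2 (R : realType) (lambda gamma c : R)
    (lambda01 : 0 < lambda < 1) (gamma_gt0 : 0 < gamma) (c_gt0 : 0 < c)
    (gammaB4 : (1 - lambda) / lambda < gamma) :
  0 < beta_const lambda gamma c /\
  exists L : R, 0 < L /\
  forall (T : R) (phi psi : R -> R) (b : R * R -> R) (ystar Y0 : R)
    (d : measure_display) (Omega : measurableType d) (P : probability Omega R)
    (Z Y : R -> {RV P >-> R}),
  0 < T ->
  holder_continuous T lambda phi ->
  holder_continuous T lambda psi ->
  (forall t, t \in `[0, T] -> phi t < psi t) ->
  phi 0 < Y0 < psi 0 ->
  drift_continuous T phi psi b ->
  drift_lipschitz T phi psi b ->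
  drift_explosive T phi psi b gamma ystar c ->
  is_noise T lambda Z ->
  (forall w, Z 0 w = 0 ->
    is_solution T phi psi b Y0 (fun t => Z t w) (fun t => Y t w)) ->
  (forall (Lambda : {RV P >-> R}) (K : R),
    is_holder_constant T lambda Z Lambda ->
    (forall s t, t \in `[0, T] -> s \in `[0, T] ->
      `|phi t - phi s| + `|psi t - psi s| <= K * `|t - s| `^ lambda) ->
    forall w, Z 0 w = 0 ->
    forall t, t \in `[0, T] ->
    let M := L * (Lambda_tilde lambda gamma c ystar Y0 (phi 0) (psi 0)
                    K (Lambda w)) `^ (- (1 / (gamma * lambda + lambda - 1))) in
    phi t + M <= Y t w <= psi t - M) /\
  (forall r : R, 0 < r ->
    (exists2 Lambda : {RV P >-> R},
       is_holder_constant T lambda Z Lambda &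
       ('E_P[fun w => ((Lambda w) `^ (r / (gamma * lambda + lambda - 1)))%R]
         < +oo)%E) ->
    (\int[P]_w ereal_sup
       [set ((Y t w - phi t) `^ (- r))%R%:E | t in `[0%R, T]] < +oo)%E /\
    (\int[P]_w ereal_sup
       [set ((psi t - Y t w) `^ (- r))%R%:E | t in `[0%R, T]] < +oo)%E).
Proof.
have q0 : 0 < gamma * lambda + lambda - 1.
  move: gammaB4; have /andP[l0 _] := lambda01; rewrite ltr_pdivrMr//; lra.
split; first exact: beta_const_gt0.
exists (barrier_const lambda gamma c); split; first exact: barrier_const_gt0.
move=> T phi psi b ystar Y0 d Omega P Z Y T0 [C1 hphi] [C2 hpsi] _ Y0in cb _ eb.
move=> [Z0 _] Ysol.
have bounds (Lambda : {RV P >-> R}) (K : R) :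
    is_holder_constant T lambda Z Lambda ->
    (forall s t, t \in `[0, T] -> s \in `[0, T] ->
      `|phi t - phi s| + `|psi t - psi s| <= K * `|t - s| `^ lambda) ->
    forall w, Z 0 w = 0 -> forall t, t \in `[0, T] ->
    let M := barrier_const lambda gamma c *
      (Lambda_tilde lambda gamma c ystar Y0 (phi 0) (psi 0) K (Lambda w))
        `^ (- (1 / (gamma * lambda + lambda - 1))) in
    phi t + M <= Y t w <= psi t - M.
  move=> hL hK w Zw t tT.
  apply: (sample_path_bounds R lambda gamma c T ystar Y0 (Lambda w) K phi psi
    (Z^~ w) (Y^~ w) b) => //.
  - exact: (hL w).1.
  - exact: (hL w).2.
  - exact: Ysol.
split=> // r r0 [Lambda hL EL].
have hK : forall s t, t \in `[0, T] -> s \in `[0, T] ->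
    `|phi t - phi s| + `|psi t - psi s| <= (C1 + C2) * `|t - s| `^ lambda.
  by move=> s t tT sT; rewrite mulrDl lerD ?hphi ?hpsi.
pose kappa := Num.max (C1 + C2) ((4 * beta_const lambda gamma c) `^ (lambda - 1) *
     (Num.min (Num.min (Y0 - phi 0) ystar) (psi 0 - Y0) / 2)
       `^ (1 - lambda - gamma * lambda)).
have LtildeE w : Lambda_tilde lambda gamma c ystar Y0 (phi 0) (psi 0)
    (C1 + C2) (Lambda w) = Num.max (Lambda w) kappa by rewrite /Lambda_tilde maxA.
have L0 := barrier_const_gt0 _ _ gamma _ lambda01 c_gt0.
have S0 : [set` `[0, T]] 0 by rewrite /= in_itv/= lexx ltW.
have EL' : ('E_P[fun w =>
    (Lambda w `^ (1 / (gamma * lambda + lambda - 1) * r))%R] < +oo)%E.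
  move: EL; rewrite (_ : r / _ = 1 / (gamma * lambda + lambda - 1) * r)//.
  by rewrite mulrC mul1r.
have mL : measurable_fun [set: Omega] Lambda by exact: measurable_funPT.
split.
- apply: (integral_sup_powRN_lty _ _ _ _ _ 0 (fun t w => Y t w - phi t)
    _ _ _ kappa _ S0 L0 r0 mL (fun w => (hL w).1) EL').
  apply: filterS Z0 => w Zw t tT; rewrite -LtildeE.
  by have /andP[+ _] := bounds _ _ hL hK w Zw t tT; rewrite addrC -lerBrDr.
- apply: (integral_sup_powRN_lty _ _ _ _ _ 0 (fun t w => psi t - Y t w)
    _ _ _ kappa _ S0 L0 r0 mL (fun w => (hL w).1) EL').
  apply: filterS Z0 => w Zw t tT; rewrite -LtildeE.
  by have /andP[_] := bounds _ _ hL hK w Zw t tT; rewrite lerBrDr addrC -lerBrDr.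
Qed.
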